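(* Let $Y$ be a real Hilbert space. Suppose that $X\subset Y$ and let $v\colon X\to Y$. Suppose that for all finite $m\leq \dim Y$, all $x,x_1,\dotsc,x_m\in X$ and all non-negative real numbers $t_1,\dotsc,t_m$ that sum up to one, $$\Big\langle v(x)-\sum_{i=1}^m t_i v(x_i),\,x-\sum_{i=1}^m t_i x_i\Big\rangle\leq \Big\lVert x-\sum_{i=1}^m t_i x_i\Big\rVert^2 .$$ Then for any closed, bounded, convex set $K\subset Y$, for any $A\subset X$, and for any map $u\colon A\to Y$ of $1$-semi-bounded strain such that $u(x)-v(x)\in K$ for all $x\in A$, there exists an extension $\tilde u\colon X\to Y$ of $u$ of $1$-semi-bounded strain such that $\tilde u(x)-v(x)\in K$ for all $x\in X$.
   Context: For a subset $A$ of a Hilbert space $Y$, a map $u\colon A\to Y$ is of $1$-semi-bounded strain if $\langle u(x)-u(y),x-y\rangle\leq\lVert x-y\rVert^2$ for all $x,y\in A$. An extension of $u\colon A\to Y$ to $X\supset A$ is a map $\tilde u\colon X\to Y$ with $\tilde u|_A=u$. ''Finite $m\leq \dim Y$'' means any positive integer $m$ with $m\leq\dim Y$ (any positive integer if $\dim Y=\infty$).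
   Formalization: The set K is additionally assumed nonempty; for K and A both empty and X nonempty (e.g. v = 0, X = Y) the claim as written is false, and K is automatically nonempty whenever A is. *)

(* Defs.v *)
From HB Require Import structures.
From mathcomp Require Import all_boot all_order all_algebra.
From mathcomp Require Import sesquilinear.
From mathcomp Require Import all_classical all_reals all_analysis.

Set Implicit Arguments.
Unset Strict Implicit.
Unset Printing Implicit Defensive.

Import Order.TTheory GRing.Theory Num.Theory.
Import numFieldNormedType.Exports.

Local Open Scope classical_set_scope.
Local Open Scope ring_scope.

(* A real Hilbert space is a complete normed space [Y] together with a
   positive definite symmetric bilinear form [dot] inducing its norm. *)
Definition induces_norm (R : realType) (Y : completeNormedModType R)
    (dot : {dot Y for idfun}) : Prop :=
  forall x : Y, dot x x = `|x| ^+ 2.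

(* Partial maps [A -> Y] are represented by total maps [Y -> Y] whose values
   outside [A] are irrelevant. *)
Definition semi_bounded_strain1 (R : realType) (Y : completeNormedModType R)
    (dot : {dot Y for idfun}) (A : set Y) (u : Y -> Y) : Prop :=
  forall x y : Y, A x -> A y -> dot (u x - u y) (x - y) <= `|x - y| ^+ 2.

Definition has_dim (R : realType) (V : lmodType R) (d : nat) : Prop :=
  exists e : 'I_d -> V, forall y : V,
    exists! c : 'rV[R]_d, y = \sum_(i < d) c 0 i *: e i.

(* [m <= dim V], where [dim V] is infinite if [V] has no finite basis.  Finite
   algebraic and Hilbert dimensions agree, so no orthonormality is needed. *)
Definition le_dim (R : realType) (V : lmodType R) (m : nat) : Prop :=
  forall d : nat, has_dim V d -> (m <= d)%N.

(* Main.v *)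
Require Import Defs.
From HB Require Import structures.
From mathcomp Require Import all_boot all_order all_algebra.
From mathcomp Require Import sesquilinear.
From mathcomp Require Import all_classical all_reals all_analysis.
From mathcomp Require Import ring lra.

Set Implicit Arguments.
Unset Strict Implicit.
Unset Printing Implicit Defensive.

Import Order.TTheory GRing.Theory Num.Theory.
Import numFieldNormedType.Exports.

Local Open Scope classical_set_scope.
Local Open Scope ring_scope.

(** By Zorn's lemma it is enough to extend [u] to one further point [x0].
The value sought is [k + v x0] with [k] in [K] and, for every pair [(a, w)] of
the graph so far, [dot (k + v x0 - w) (x0 - a) <= `|x0 - a| ^+ 2].  These are
half-space conditions on [k], and since [K] is weakly compact and convex, the
minimax principle ([minimax]) lets one treat a single nonnegative combination
of finitely many of them at a time: for weights [t] and points [(a_i, w_i)] it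
suffices to find [k] in [K], depending on [t], at which the weighted sum of the
excesses is nonpositive.

For weights of total [1] the choice [k = \sum t_i (w_i - v a_i)] works
([averaged_shift]): a Chebyshev-type inequality for the monotone family
[w_i - a_i] replaces the weighted sum by one inner product at the barycenters,
and what remains is the hypothesis on [v] at [x0] and the [a_i].

That hypothesis is only available for at most [dim Y] points, so the number of
points must be reduced.  The identity satisfies the analogous inequality for
any number of points, so the same argument with the identity for [v] and a
large ball for [K] gives a [y] such that [k = y - v x0] satisfies all the
half-space conditions of a finite family ([finite_extension]), perhaps outside
[K].  Measured from [y], the conditions read
[dot (k - (y - v x0)) (x0 - a_i) <= s_i] with [0 <= s_i], and Caratheodory's
reduction ([conic_caratheodory]) moves the weights onto linearly independent
vectors [x0 - a_i] while keeping [\sum t_i (x0 - a_i)] and not increasing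
[\sum t_i s_i].  Hence the weighted excess can only grow, and at most [dim Y]
points remain. *)

(** * Real inner products *)

Section inner_product.
Variables (R : realType) (Y : completeNormedModType R).
Variables (dot : {dot Y for idfun}) (dot_norm : induces_norm dot).
Implicit Types x y z b : Y.

Lemma dotC x y : dot x y = dot y x.
Proof. by rewrite hermC expr0 mul1r. Qed.

Lemma dotDl x y z : dot (x + y) z = dot x z + dot y z.
Proof. exact: linearDl. Qed.

Lemma dotBl x y z : dot (x - y) z = dot x z - dot y z.
Proof. exact: linearBl. Qed.

Lemma dotZl (a : R) x y : dot (a *: x) y = a * dot x y.
Proof. exact: linearZl_LR. Qed.

Lemma dot_suml n (f : 'I_n -> Y) y :
  dot (\sum_(i < n) f i) y = \sum_(i < n) dot (f i) y.
Proof.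
by elim/big_rec2: _ => [|i u w _ <-]; [exact: linear0l | exact: dotDl].
Qed.

Lemma dotDr x y z : dot x (y + z) = dot x y + dot x z.
Proof. by rewrite dotC dotDl !(dotC x). Qed.

Lemma dotBr x y z : dot x (y - z) = dot x y - dot x z.
Proof. by rewrite dotC dotBl !(dotC x). Qed.

Lemma dotZr (a : R) x y : dot x (a *: y) = a * dot x y.
Proof. by rewrite dotC dotZl dotC. Qed.

Lemma dotNr x y : dot x (- y) = - dot x y.
Proof. exact: linearNr. Qed.

Lemma dot_sumr n x (f : 'I_n -> Y) :
  dot x (\sum_(i < n) f i) = \sum_(i < n) dot x (f i).
Proof. by rewrite dotC dot_suml; apply: eq_bigr => i _; exact: dotC. Qed.

Lemma parallelogram x y :
  `|x + y| ^+ 2 + `|x - y| ^+ 2 = 2 * `|x| ^+ 2 + 2 * `|y| ^+ 2.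
Proof. by rewrite -!dot_norm !(dotBl, dotBr, dotDl, dotDr) (dotC y x); ring. Qed.

Lemma polarization x y :
  dot x y = (`|x + y| ^+ 2 - `|x - y| ^+ 2) / 4.
Proof.
by rewrite -!dot_norm !(dotBl, dotBr, dotDl, dotDr) (dotC y x); field.
Qed.

Lemma Cauchy_Schwarz x y : dot x y ^+ 2 <= `|x| ^+ 2 * `|y| ^+ 2.
Proof.
have [->|y0] := eqVneq y 0.
  by rewrite normr0 expr0n mulr0 dotC [dot 0 x]linear0l expr0n.
have ny : 0 < `|y| ^+ 2 by rewrite exprn_gt0 ?normr_gt0.
set z := `|y| ^+ 2 *: x - dot x y *: y.
have := sqr_ge0 `|z|; rewrite -(dot_norm z) /z !(dotBl, dotBr, dotZl, dotZr).
rewrite (dotC y x) !dot_norm => h.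
rewrite -subr_ge0 -(pmulr_rge0 _ ny); apply: le_trans h _.
by rewrite le_eqVlt; apply/orP; left; apply/eqP; ring.
Qed.

(** Polarization turns the continuity of the norm into that of [dot ^~ b]. *)
Lemma closed_halfspace b (c : R) : closed [set x | dot x b <= c].
Proof.
apply: (@closed_comp _ _ (dot ^~ b) [set r | r <= c]); last exact: closed_le.
move=> x _.
rewrite (_ : dot ^~ b = fun x => (`|x + b| ^+ 2 - `|x - b| ^+ 2) / 4); last first.
  by apply/funext => z; rewrite polarization.
apply: cvgMl; apply: cvgB; apply: cvgM; apply: cvg_norm.
all: by [apply: cvgD; [exact: cvg_id | exact: cvg_cst]
        |apply: cvgB; [exact: cvg_id | exact: cvg_cst]].
Qed.

End inner_product.

(** * Weak compactness of bounded closed convex sets *)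

Section weak_compactness.
Variables (R : realType) (Y : completeNormedModType R).
Variables (dot : {dot Y for idfun}) (dot_norm : induces_norm dot).
Implicit Types (A B K : set Y) (x y b : Y) (l e : R).

Lemma convex_set_comb K l x y : convex_set K -> 0 <= l -> l <= 1 ->
  K x -> K y -> K (l *: x + (1 - l) *: y).
Proof.
move=> cK l0 l1 Kx Ky.
have l01 : Itv.spec (@Itv.num_sem R) (Itv.Real `[0%Z, 1%Z]) l.
  by apply/and3P; split => //; rewrite ?num_real// bnd_simp.
have /(_ (Itv.mk l01)) := cK x y _ (mem_set Kx) (mem_set Ky).
by rewrite inE.
Qed.

(** Weak compactness without the weak topology.  The least norm on a member
of the family increases along the direction towards a limit [D].  Points of a
small member whose norm is close to [D] are close to each other, because by the
parallelogram law their midpoint, also in that member, would otherwise have too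
small a norm.  So these sets generate a Cauchy filter, and its limit lies in
every member. *)
Lemma directed_closed_convex_inter (F : set (set Y)) (M : R) :
    F !=set0 ->
    (forall A, F A -> [/\ closed A, convex_set A & A !=set0]) ->
    (forall A, F A -> forall x, A x -> `|x| <= M) ->
    (forall A B, F A -> F B -> exists2 C, F C & C `<=` A `&` B) ->
  exists x, forall A, F A -> A x.
Proof.
move=> [A0 FA0] Fccn FM Fdir.
pose norms A := [set `|x| | x in A].
have norms_inf A : F A -> has_inf (norms A).
  move=> /Fccn[_ _ [a Aa]]; split; first by exists `|a|, a.
  by exists 0 => _ [x _ <-].
pose S := [set inf (norms A) | A in F].
have S_sup : has_sup S.
  split; first by exists (inf (norms A0)), A0.
  exists M => _ [A FA <-]; have [_ _ [a Aa]] := Fccn _ FA.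
  apply: (@le_trans _ _ `|a|); last exact: FM FA _ Aa.
  by apply: ge_inf; [case: (norms_inf _ FA) | exists a].
pose D := sup S.
have D0 : 0 <= D.
  apply: (@le_trans _ _ (inf (norms A0))); last first.
    by apply: ub_le_sup; [case: S_sup | exists A0].
  by apply: lb_le_inf; [case: (norms_inf _ FA0) | move=> _ [x _ <-]].
pose G (p : set Y * R) := [set x | p.1 x /\ `|x| < D + p.2].
pose I := [set p : set Y * R | F p.1 /\ 0 < p.2].
have G0 p : I p -> G p !=set0.
  case: p => A e [/= FA e0].
  have [_ [x Ax <-] xe] := inf_adherent e0 (norms_inf _ FA).
  exists x; split => //=; apply: lt_le_trans xe _.
  by rewrite lerD2r; apply: ub_le_sup; [case: S_sup | exists A].
have Gfilter : Filter (filter_from I G).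
  apply: filter_from_filter; first by exists (A0, 1); split => /=.
  move=> [A e] [B e'] [/= FA e0] [/= FB e'0].
  have [C FC CAB] := Fdir _ _ FA FB.
  exists (C, Num.min e e'); first by split => //=; rewrite lt_min e0.
  by move=> x [/= /CAB[Ax Bx]]; rewrite -ltrBlDl lt_min !ltrBlDl => /andP[].
have Gproper : ProperFilter (filter_from I G) by exact: filter_from_proper.
have Gcauchy : cauchy (filter_from I G).
  apply: cauchy_exP => e e0.
  pose d := Num.min 1 (e ^+ 2 / (16 * D + 5)).
  have e20 : 0 < e ^+ 2 by rewrite exprn_gt0.
  have d0 : 0 < d by rewrite lt_min ltr01 divr_gt0//; lra.
  have d1 : d <= 1 by rewrite ge_min lexx.
  have de : d * (16 * D + 5) <= e ^+ 2.
    by rewrite -ler_pdivlMr ?ge_min ?lexx ?orbT//; lra.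
  have [_ [A FA <-] Dd] := sup_adherent d0 S_sup.
  have [_ cA _] := Fccn _ FA.
  have Id : I (A, d) by split.
  have [x [/= Ax xD]] := G0 _ Id.
  exists x; exists (A, d) => // y [/= Ay yD].
  rewrite -ball_normE /ball_ /=.
  (* the midpoint lies in A, so its norm is not much below D *)
  pose z := 2^-1 *: x + (1 - 2^-1) *: y.
  have Az : A z by apply: convex_set_comb => //; lra.
  have Dz : D - d < `|z|.
    by apply: lt_le_trans Dd _; apply: ge_inf; [case: (norms_inf _ FA)|exists z].
  have zE : x + y = 2 *: z.
    have half1 : 2 * 2^-1 = 1 :> R by rewrite mulfV.
    have half2 : 2 * (1 - 2^-1) = 1 :> R by lra.
    by rewrite /z scalerDr !scalerA half1 half2 !scale1r.
  have := parallelogram dot_norm x y.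
  rewrite zE normrZ ger0_norm// => par.
  rewrite -(ltr_pXn2r (n := 2)) ?nnegrE// ?(ltW e0)//.
  have z0 := normr_ge0 z; have x0 := normr_ge0 x; have y0 := normr_ge0 y.
  have xx : `|x| ^+ 2 <= (D + d) ^+ 2 by rewrite ler_pXn2r ?nnegrE//; lra.
  have yy : `|y| ^+ 2 <= (D + d) ^+ 2 by rewrite ler_pXn2r ?nnegrE//; lra.
  have zz : D ^+ 2 - 2 * D * d <= `|z| ^+ 2.
    have [Dd'|dD] := leP D d.
      by apply: le_trans (sqr_ge0 `|z|); rewrite expr2; nra.
    have : (D - d) ^+ 2 <= `|z| ^+ 2 by rewrite ler_pXn2r ?nnegrE//; lra.
    by apply: le_trans; rewrite sqrrB; have := sqr_ge0 d; lra.
  have dd : d ^+ 2 <= d by rewrite expr2 ger_pMl.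
  rewrite exprMn in par.
  have sqD : (D + d) ^+ 2 = D ^+ 2 + 2 * D * d + d ^+ 2 by ring.
  lra.
have := cauchy_cvg (filter_from I G) Gcauchy; set x := lim _ => xlim.
exists x => A FA; have [Acl _ _] := Fccn _ FA.
apply: Acl => B /xlim FB.
have FA1 : filter_from I G A by exists (A, 1) => [|y []]; first by split => /=.
by have [y] := @filter_ex _ _ Gproper _ (filterI FA1 FB); exists y.
Qed.

End weak_compactness.

(** * A minimax principle for half-spaces *)

Section minimax.
Variables (R : realType) (Y : completeNormedModType R).
Variables (dot : {dot Y for idfun}) (dot_norm : induces_norm dot).
Variables (K : set Y) (M : R).
Hypotheses (Kcl : closed K) (Kcv : convex_set K) (K0 : K !=set0).
Hypothesis (KM : forall x, K x -> `|x| <= M).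

Lemma sqr_posD (a h : R) : Num.max 0 (a + h) ^+ 2 <= (Num.max 0 a + h) ^+ 2.
Proof.
have [ah|ah] := leP 0 (a + h); have [a0|a0] := leP 0 a; rewrite ?add0r;
  rewrite ?expr0n ?sqr_ge0 //.
by rewrite ler_pXn2r ?nnegrE//; lra.
Qed.

(** Take [k] almost minimizing the sum of the squared positive parts
[t_i = max 0 (g_i k)] over [K], and let [k'] in [K] satisfy
[\sum t_i g_i k' <= 0].  The derivative of that sum towards [k'] is at most
[- 2 \sum t_i g_i k = - 2 \sum t_i ^ 2], so a small step towards [k'] would
decrease it substantially unless it is already small.  An approximate minimizer
suffices, since the slack [e] is removed by compactness afterwards. *)
Lemma finite_approx_minimax n (b : 'I_n -> Y) (c : 'I_n -> R) (e : R) :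
    (forall t : 'I_n -> R, (forall i, 0 <= t i) ->
      exists2 k, K k & \sum_(i < n) t i * (dot k (b i) - c i) <= 0) ->
    0 < e ->
  exists2 k, K k & forall i, dot k (b i) <= c i + e.
Proof.
move=> Kt e0.
pose g i k := dot k (b i) - c i.
pose f k := \sum_(i < n) Num.max 0 (g i k) ^+ 2.
have f_ge0 k : 0 <= f k by apply: sumr_ge0 => i _; exact: sqr_ge0.
have f_inf : has_inf [set f k | k in K].
  by split; [case: K0 => k Kk; exists (f k), k | exists 0 => _ [k _ <-]].
pose D := \sum_(i < n) (2 * M) ^+ 2 * `|b i| ^+ 2.
have D0 : 0 <= D by apply: sumr_ge0 => i _; rewrite mulr_ge0 ?sqr_ge0.
(* l is both the step length and the square root of the minimization error:
   comparing f k with f at the new point then gives 2 * f k < l * (1 + D) *)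
pose l := Num.min 1 (e ^+ 2 / (1 + D)).
have e20 : 0 < e ^+ 2 by rewrite exprn_gt0.
have l0 : 0 < l by rewrite lt_min ltr01 divr_gt0//; lra.
have l1 : l <= 1 by rewrite ge_min lexx.
have le2 : l * (1 + D) <= e ^+ 2.
  by rewrite -ler_pdivlMr ?ge_min ?lexx ?orbT//; lra.
have l20 : 0 < l ^+ 2 by rewrite exprn_gt0.
have [_ [k Kk <-] fk] := inf_adherent l20 f_inf.
pose t i := Num.max 0 (g i k).
have t0 i : 0 <= t i by rewrite /t le_max lexx.
have [k' Kk' k't] := Kt _ t0.
pose h := k' - k.
have Kl : K (l *: k' + (1 - l) *: k).
  by apply: convex_set_comb => //; exact: ltW.
have lE : l *: k' + (1 - l) *: k = k + l *: h.
  by rewrite /h scalerBr scalerBl scale1r addrCA addrA addrAC -addrA addrCA addrA.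
have fkl : f (k + l *: h) <=
    f k + 2 * l * \sum_(i < n) t i * dot h (b i) + l ^+ 2 * D.
  rewrite /f /D !mulr_sumr -!big_split /=; apply: ler_sum => i _.
  have -> : g i (k + l *: h) = g i k + l * dot h (b i).
    by rewrite /g dotDl dotZl; ring.
  apply: le_trans (sqr_posD _ _) _; rewrite -/(t i).
  have hM : dot h (b i) ^+ 2 <= (2 * M) ^+ 2 * `|b i| ^+ 2.
    apply: le_trans (Cauchy_Schwarz dot_norm _ _) _.
    rewrite ler_wpM2r ?sqr_ge0// ler_pXn2r ?nnegrE//.
      apply: le_trans (ler_normB _ _) _.
      by have := KM Kk; have := KM Kk'; lra.
    by have := le_trans (normr_ge0 k) (KM Kk); lra.
  have lhM := ler_wpM2l (ltW l20) hM.
  lra.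
have fE : f k = \sum_(i < n) t i * g i k.
  apply: eq_bigr => i _; rewrite /t; case: leP => _; first by rewrite expr2.
  by rewrite expr0n mul0r.
have th : \sum_(i < n) t i * dot h (b i) <= - f k.
  rewrite (_ : \sum_(i < n) t i * dot h (b i) =
    \sum_(i < n) t i * (dot k' (b i) - c i) - f k); first by lra.
  rewrite fE -sumrB; apply: eq_bigr => i _.
  by rewrite /g /h dotBl; ring.
have fkl' : inf [set f k | k in K] <= f (k + l *: h).
  by apply: ge_inf; [case: f_inf | exists (k + l *: h); rewrite -?lE].
have fe : f k <= e ^+ 2.
  have lf : l * (2 * f k) < l * (l * (1 + D)).
    by have := ler_wpM2l (ltW l0) th; lra.
  by rewrite ltr_pM2l// in lf; have := f_ge0 k; lra.
exists k => // i.
have : t i <= e.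
  rewrite -(ler_pXn2r (n := 2)) ?nnegrE// ?(ltW e0)//.
  apply: le_trans fe; rewrite /f (bigD1 i)//= lerDl.
  by apply: sumr_ge0 => j _; exact: sqr_ge0.
by rewrite /t ge_max /g => /andP[_]; lra.
Qed.

(** The sets of points of [K] that satisfy finitely many constraints up to an
error [e] are nonempty by [finite_approx_minimax] and form a directed family of
closed convex sets. *)
Lemma minimax (S : set (Y * R)) :
    (forall n (p : 'I_n -> Y * R) (t : 'I_n -> R),
      (forall i, S (p i)) -> (forall i, 0 <= t i) ->
      exists2 k, K k & \sum_(i < n) t i * (dot k (p i).1 - (p i).2) <= 0) ->
  exists2 k, K k & forall p, S p -> dot k p.1 <= p.2.
Proof.
move=> Kt.
pose C (q : seq (Y * R) * R) :=
  [set k | K k /\ forall p, p \in q.1 -> dot k p.1 <= p.2 + q.2].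
pose I := [set q : seq (Y * R) * R | (forall p, p \in q.1 -> S p) /\ 0 < q.2].
have [k kC] : exists k, forall A, [set C q | q in I] A -> A k.
  apply: (directed_closed_convex_inter dot_norm (M := M)).
  - by exists (C ([::], 1)), ([::], 1).
  - move=> _ [[s e] [/= sS e0] <-]; split.
    + rewrite (_ : C _ = K `&` \bigcap_(p in [set` s]) 
        [set k | dot k p.1 <= p.2 + e]); last by apply/seteqP; split.
      apply: closedI => //; apply: closed_bigI => p _.
      exact: closed_halfspace.
    + move=> x y l /set_mem[/= Kx xs] /set_mem[/= Ky ys]; apply/mem_set; split.
        exact/set_mem/(Kcv l (mem_set Kx) (mem_set Ky)).
      move=> p ps; have xp := xs _ ps; have yp := ys _ ps.
      have -> : conv l x y = l%:num *: x + (1 - l%:num : R) *: y by [].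
      rewrite dotDl !dotZl.
      have l0 : 0 <= l%:num by [].
      have l1 : 0 <= 1 - l%:num by rewrite subr_ge0.
      by have := lerD (ler_wpM2l l0 xp) (ler_wpM2l l1 yp); rewrite /=; lra.
    + have [||k Kk kp] := @finite_approx_minimax (size s)
        (fun i => (tnth (in_tuple s) i).1) (fun i => (tnth (in_tuple s) i).2) e.
      * by move=> t t0; apply: (Kt _ (tnth (in_tuple s))) => // i; apply/sS/mem_tnth.
      * exact: e0.
      by exists k; split => // p /(tnthP (in_tuple s))[i ->].
  - by move=> _ [[s e] _ <-] x [/KM].
  - move=> _ _ [[s e] [/= sS e0] <-] [[s' e'] [/= sS' e'0] <-].
    exists (C (s ++ s', Num.min e e')).
      exists (s ++ s', Num.min e e') => //; split => /=; last by rewrite lt_min e0.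
      by move=> p; rewrite mem_cat => /orP[/sS|/sS'].
    move=> x [Kx xs]; split; split => //= p ps.
      apply: le_trans (xs _ _) _; first by rewrite /= mem_cat ps.
      by rewrite /= lerD2l ge_min lexx.
    apply: le_trans (xs _ _) _; first by rewrite /= mem_cat ps orbT.
    by rewrite /= lerD2l ge_min lexx orbT.
have kCq q : I q -> C q k by move=> Iq; apply: kC; exists q.
exists k; first by case: (kCq ([::], 1)).
move=> p Sp; apply/ler_addgt0Pr => e e0.
have [|_] := kCq ([:: p], e); last by apply; rewrite mem_seq1.
by split => // q; rewrite mem_seq1 => /eqP ->.
Qed.

End minimax.

(** * Conic combinations and dimension *)

Section conic_combinations.
Variables (R : realFieldType) (V : lmodType R).

Definition linearly_independent n (b : 'I_n -> V) : Prop :=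
  forall r : 'I_n -> R, \sum_(i < n) r i *: b i = 0 -> forall i, r i = 0.

(** Up to changing the sign of a nontrivial relation.  A positive coefficient
comes for free when the weighted sum is positive, as [s] is nonnegative; when
that sum vanishes either sign is admissible. *)
Lemma dependent_relation n (b : 'I_n -> V) (s : 'I_n -> R) :
    (forall i, 0 <= s i) -> ~ linearly_independent b ->
  exists r : 'I_n -> R, [/\ \sum_(i < n) r i *: b i = 0,
    0 <= \sum_(i < n) r i * s i & exists i, 0 < r i].
Proof.
move=> s0 /existsNP[r /not_implyP[rb /existsNP[j /eqP rj]]].
wlog rs : r rb rj / 0 <= \sum_(i < n) r i * s i.
  move=> H; have [|rs] := leP 0 (\sum_(i < n) r i * s i); first exact: H.
  apply: (H (fun i => - r i)); rewrite ?oppr_eq0//.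
    by under eq_bigr do rewrite scaleNr; rewrite sumrN rb oppr0.
  by under eq_bigr do rewrite mulNr; rewrite sumrN oppr_ge0 ltW.
have [[i ri]|/forallNP rn] := pselect (exists i, 0 < r i).
  by exists r; split => //; exists i.
have {}rn i : r i <= 0 by rewrite leNgt; apply/negP.
have rs0 : \sum_(i < n) r i * s i = 0.
  apply/eqP; rewrite eq_le rs andbT; apply: sumr_le0 => i _.
  by rewrite mulr_le0_ge0.
exists (fun i => - r i); split.
- by under eq_bigr do rewrite scaleNr; rewrite sumrN rb oppr0.
- by under eq_bigr do rewrite mulNr; rewrite sumrN rs0 oppr0.
- by exists j; rewrite oppr_gt0 lt_neqAle rj rn.
Qed.

(** As long as the vectors are dependent, subtract from [t] the largest
multiple of a relation given by [dependent_relation] that keeps it nonnegative.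
This cancels a coefficient, leaves the vector sum unchanged and does not
increase the cost [\sum t i * s i]. *)
Lemma conic_caratheodory n (b : 'I_n -> V) (s t : 'I_n -> R) :
    (forall i, 0 <= s i) -> (forall i, 0 <= t i) ->
  exists m (f : 'I_m -> 'I_n) (t' : 'I_m -> R),
    [/\ forall i, 0 <= t' i,
        \sum_(i < m) t' i *: b (f i) = \sum_(i < n) t i *: b i,
        \sum_(i < m) t' i * s (f i) <= \sum_(i < n) t i * s i
      & linearly_independent (b \o f)].
Proof.
elim: n b s t => [|n IHn] b s t s0 t0.
  exists 0%N, id, t; split => //; by move=> r _ [].
have [bfree|bdep] := pselect (linearly_independent b).
  by exists n.+1, id, t.
have [r [rb rs [i0 ri0]]] := dependent_relation s0 bdep.
have [j rj jmin] := arg_minP (fun i => t i / r i) (P := fun i => 0 < r i) ri0.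
pose e := t j / r j.
have e0 : 0 <= e by rewrite divr_ge0// ltW.
pose u i := t i - e * r i.
have u0 i : 0 <= u i.
  rewrite subr_ge0; have [ri|ri] := ltP 0 (r i).
    by rewrite -ler_pdivlMr//; exact: jmin.
  by apply: le_trans (t0 i); rewrite mulr_ge0_le0.
have uj : u j = 0 by rewrite /u /e divfK ?subrr// gt_eqF.
have ub : \sum_(i < n.+1) u i *: b i = \sum_(i < n.+1) t i *: b i.
  under eq_bigr do rewrite scalerBl -scalerA.
  by rewrite sumrB -scaler_sumr rb scaler0 subr0.
have us : \sum_(i < n.+1) u i * s i <= \sum_(i < n.+1) t i * s i.
  under eq_bigr do rewrite mulrBl -mulrA.
  by rewrite sumrB -mulr_sumr gerBl mulr_ge0.
have [m [f [t' [t'0 t'b t's free]]]] := IHn (b \o lift j) (s \o lift j)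
  (u \o lift j) (fun i => s0 _) (fun i => u0 _).
exists m, (lift j \o f), t'; split => //.
  by rewrite -ub (bigD1_ord j)//= uj scale0r add0r -t'b.
by apply: le_trans us; rewrite (bigD1_ord j)//= uj mul0r add0r.
Qed.

End conic_combinations.

Lemma le_dim_independent (R : realType) (V : lmodType R) n (b : 'I_n -> V) :
  linearly_independent b -> le_dim V n.
Proof.
move=> bfree d [e eP]; rewrite leqNgt; apply/negP => dn.
have /choice[c cE] i : exists c : 'rV[R]_d, b i = \sum_(j < d) c 0 j *: e j.
  by have [c [? _]] := eP (b i); exists c.
pose C := \matrix_(i < n, j < d) c i 0 j.
have : kermx C != 0.
  rewrite -mxrank_eq0 mxrank_ker subn_eq0 -ltnNge.
  exact: leq_ltn_trans (rank_leq_col _) dn.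
move=> /rowV0Pn[r /sub_kermxP rC /eqP]; apply; apply/rowP => i; rewrite mxE.
apply: (bfree (fun i => r 0 i)).
under eq_bigr do rewrite cE scaler_sumr.
rewrite exchange_big big1//= => j _.
under eq_bigr do rewrite scalerA.
rewrite -scaler_suml; have /rowP/(_ j) := rC; rewrite !mxE => rj.
rewrite (eq_bigr (fun k => r 0 k * C k j)) ?rj ?scale0r// => k _.
by rewrite mxE.
Qed.

(** * The averaged candidate *)

Section averaging.
Variables (R : realType) (Y : completeNormedModType R).
Variables (dot : {dot Y for idfun}) (dot_norm : induces_norm dot).

(** Chebyshev's sum inequality: the double sum of
[t i * t j * dot (q i - q j) (b i - b j)] is twice the difference of the two
sides. *)
Lemma antitone_average n (q b : 'I_n -> Y) (t : 'I_n -> R) :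
    (forall i j, dot (q i - q j) (b i - b j) <= 0) ->
    (forall i, 0 <= t i) -> \sum_(i < n) t i = 1 ->
  \sum_(i < n) t i * dot (q i) (b i) <=
    dot (\sum_(i < n) t i *: q i) (\sum_(i < n) t i *: b i).
Proof.
move=> qb t0 t1.
set S := (X in X <= _); set Q := \sum_(i < n) t i *: q i.
set B := \sum_(i < n) t i *: b i.
have sumB x : \sum_(j < n) t j * dot x (b j) = dot x B.
  by rewrite dot_sumr; apply: eq_bigr => j _; rewrite dotZr.
have sumQ x : \sum_(j < n) t j * dot (q j) x = dot Q x.
  by rewrite dot_suml; apply: eq_bigr => j _; rewrite dotZl.
have row i : \sum_(j < n) t j * dot (q i - q j) (b i - b j) =
    dot (q i) (b i) - dot (q i) B - dot Q (b i) + S.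
  rewrite (eq_bigr (fun j => t j * dot (q i) (b i) - t j * dot (q i) (b j)
    - t j * dot (q j) (b i) + t j * dot (q j) (b j))); last first.
    by move=> j _; rewrite !(dotBl, dotBr); ring.
  by rewrite big_split !sumrB -mulr_suml t1 mul1r sumB sumQ.
have all : \sum_(i < n) t i * (\sum_(j < n) t j * dot (q i - q j) (b i - b j)) =
    S - dot Q B - dot Q B + S.
  rewrite (eq_bigr (fun i => t i * dot (q i) (b i) - t i * dot (q i) B
    - t i * dot Q (b i) + t i * S)); last by move=> i _; rewrite row; ring.
  by rewrite big_split !sumrB -mulr_suml t1 mul1r sumB sumQ.
have : \sum_(i < n) t i * (\sum_(j < n) t j * dot (q i - q j) (b i - b j)) <= 0.
  apply: sumr_le0 => i _; apply: mulr_ge0_le0 => //.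
  by apply: sumr_le0 => j _; exact: mulr_ge0_le0.
by rewrite all; lra.
Qed.

(** With [b i = x0 - a i] and [q i = z0 - w i - b i], the bound on the strain of
[w] says exactly that [q] is antitone with respect to [b], and
[antitone_average] bounds the left-hand side by
[dot (k + \sum t i *: q i) (\sum t i *: b i)].  In [k + \sum t i *: q i] the
[w i] cancel, which leaves the inequality assumed at the barycenters. *)
Lemma averaged_shift n (a w z : 'I_n -> Y) (x0 z0 : Y) (t : 'I_n -> R) :
    (forall i j, dot (w i - w j) (a i - a j) <= `|a i - a j| ^+ 2) ->
    (forall i, 0 <= t i) -> \sum_(i < n) t i = 1 ->
    dot (z0 - \sum_(i < n) t i *: z i) (x0 - \sum_(i < n) t i *: a i)
      <= `|x0 - \sum_(i < n) t i *: a i| ^+ 2 ->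
  \sum_(i < n) t i *
    (dot (\sum_(j < n) t j *: (w j - z j)) (x0 - a i)
      - (`|x0 - a i| ^+ 2 - dot (z0 - w i) (x0 - a i))) <= 0.
Proof.
move=> wa t0 t1 z0x0.
pose b i := x0 - a i; pose q i := a i - w i + (z0 - x0).
have qdef i : q i = z0 - w i - b i.
  by rewrite /q /b opprB addrACA [RHS]addrACA (addrC z0).
set k := \sum_(j < n) t j *: (w j - z j).
have const x : \sum_(i < n) t i *: x = x by rewrite -scaler_suml t1 scale1r.
have bE : \sum_(i < n) t i *: b i = x0 - \sum_(i < n) t i *: a i.
  by rewrite -[x0 in RHS]const -sumrB; apply: eq_bigr => i _; rewrite scalerBr.
have qE : k + \sum_(i < n) t i *: q i =
    z0 - \sum_(i < n) t i *: z i - \sum_(i < n) t i *: b i.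
  rewrite -[z0 in RHS]const -!sumrB -big_split; apply: eq_bigr => i _ /=.
  rewrite -!scalerBr -scalerDr; congr (_ *: _).
  rewrite /q /b opprB addrACA (addrC (w i)) subrK [RHS]addrCA; congr (_ + _).
  by rewrite addrA (addrC (- z i)).
have qb i j : dot (q i - q j) (b i - b j) <= 0.
  have -> : b i - b j = - (a i - a j).
    by rewrite /b opprB addrC addrA subrK opprB.
  have -> : q i - q j = (a i - a j) - (w i - w j).
    rewrite /q opprD addrACA subrr addr0 !opprB.
    by rewrite (addrC (w j)) addrACA (addrC (- w i)).
  by rewrite dotNr dotBl opprB dot_norm subr_le0; exact: wa.
have := antitone_average qb t0 t1.
rewrite -(lerD2l (dot k (\sum_(i < n) t i *: b i))) -dotDl qE bE.
rewrite dotBl dot_norm => h.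
apply: (@le_trans _ _ (dot (z0 - \sum_(i < n) t i *: z i)
  (x0 - \sum_(i < n) t i *: a i) - `|x0 - \sum_(i < n) t i *: a i| ^+ 2)); last first.
  by rewrite subr_le0; exact: z0x0.
apply: le_trans h; rewrite -bE dot_sumr -big_split /=.
apply: ler_sum => i _; rewrite dotZr qdef -/(b i).
by rewrite [dot (_ - b i) _]dotBl dot_norm; lra.
Qed.

End averaging.

(** * Extension to one point *)

Section one_point_extension.
Variables (R : realType) (Y : completeNormedModType R).
Variables (dot : {dot Y for idfun}) (dot_norm : induces_norm dot).
Implicit Types (K : set Y) (G : set (Y * Y)) (x z k : Y) (p q : Y * Y).

Lemma convex_set_sum K n (f : 'I_n -> Y) (t : 'I_n -> R) : convex_set K ->
    (forall i, K (f i)) -> (forall i, 0 <= t i) -> \sum_(i < n) t i = 1 ->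
  K (\sum_(i < n) t i *: f i).
Proof.
move=> Kcv; elim: n f t => [|n IHn] f t Kf t0.
  by rewrite big_ord0 => /esym/eqP; rewrite oner_eq0.
rewrite !big_ord_recl => t1.
have [t0E|t0N] := eqVneq (t ord0) 1.
  have : \sum_(i < n) t (lift ord0 i) == 0 by apply/eqP; lra.
  rewrite psumr_eq0// => /allP tz.
  rewrite t0E scale1r big1 ?addr0// => i _.
  by have /eqP -> := tz i (mem_index_enum _); rewrite scale0r.
set r := 1 - t ord0.
have r0 : r != 0 by rewrite subr_eq0 eq_sym.
have rE : \sum_(i < n) t (lift ord0 i) = r by rewrite /r; lra.
have r_ge0 : 0 <= r by rewrite -rE; apply: sumr_ge0.
have Kr : K (\sum_(i < n) (t (lift ord0 i) / r) *: f (lift ord0 i)).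
  apply: IHn => //; first by move=> i; rewrite divr_ge0.
  by rewrite -mulr_suml rE divff.
have -> : \sum_(i < n) t (lift ord0 i) *: f (lift ord0 i) =
    (1 - t ord0) *: \sum_(i < n) (t (lift ord0 i) / r) *: f (lift ord0 i).
  rewrite scaler_sumr; apply: eq_bigr => i _.
  by rewrite scalerA -/r mulrC divfK.
by apply: convex_set_comb => //; rewrite -subr_ge0.
Qed.

Lemma exists_normalized K n (g : 'I_n -> Y -> R) : K !=set0 ->
    (forall t : 'I_n -> R, (forall i, 0 <= t i) -> \sum_(i < n) t i = 1 ->
      exists2 k, K k & \sum_(i < n) t i * g i k <= 0) ->
  forall t : 'I_n -> R, (forall i, 0 <= t i) ->
    exists2 k, K k & \sum_(i < n) t i * g i k <= 0.
Proof.
move=> [k0 Kk0] H t t0; set T := \sum_(i < n) t i.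
have [T0|T0] := eqVneq T 0.
  exists k0 => //; rewrite big1// => i _.
  have /eqP := T0; rewrite psumr_eq0// => /allP/(_ i (mem_index_enum _))/eqP ->.
  by rewrite mul0r.
have Tp : 0 < T by rewrite lt_neqAle eq_sym T0; apply: sumr_ge0.
have [||k Kk kt] := H (fun i => t i / T).
- by move=> i; rewrite divr_ge0// ltW.
- by rewrite -mulr_suml divff.
exists k => //; rewrite -(pmulr_rle0 _ (_ : 0 < T^-1)) ?invr_gt0// mulr_sumr.
by apply: le_trans kt; apply: ler_sum => i _; rewrite mulrA (mulrC T^-1).
Qed.

(** Partial maps are handled as graphs.  Single-valuedness is not imposed: two
values at one point satisfy the bound trivially. *)
Definition strain1_graph G : Prop :=
  forall p q, G p -> G q -> dot (p.2 - q.2) (p.1 - q.1) <= `|p.1 - q.1| ^+ 2.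

(** By how much the value [k + z0] at [x0] violates the strain bound against the
pair [p]; affine in [k]. *)
Definition excess (x0 z0 : Y) p k : R :=
  dot k (x0 - p.1) - (`|x0 - p.1| ^+ 2 - dot (z0 - p.2) (x0 - p.1)).

Lemma excess_le0 x0 z0 p k :
  (excess x0 z0 p k <= 0) =
  (dot (k + z0 - p.2) (x0 - p.1) <= `|x0 - p.1| ^+ 2).
Proof.
by rewrite /excess -addrA [in RHS]dotDl subr_le0 lerBrDr.
Qed.

Lemma extension_minimax K (M : R) G (x0 z0 : Y) :
    closed K -> convex_set K -> K !=set0 -> (forall k, K k -> `|k| <= M) ->
    (forall n (p : 'I_n -> Y * Y) (t : 'I_n -> R),
      (forall i, G (p i)) -> (forall i, 0 <= t i) ->
      exists2 k, K k & \sum_(i < n) t i * excess x0 z0 (p i) k <= 0) ->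
  exists2 k, K k & forall p, G p ->
    dot (k + z0 - p.2) (x0 - p.1) <= `|x0 - p.1| ^+ 2.
Proof.
move=> Kcl Kcv K0 KM H.
pose c p := (x0 - p.1, `|x0 - p.1| ^+ 2 - dot (z0 - p.2) (x0 - p.1)).
have [|k Kk kc] := minimax dot_norm Kcl Kcv K0 KM (S := [set c p | p in G]).
  move=> n q t Gq t0.
  have /choice[p pE] i : exists p, G p /\ c p = q i.
    by have [p Gp pq] := Gq i; exists p.
  have [|k Kk kt] := H n p t _ t0; first by move=> i; case: (pE i).
  exists k => //; apply: le_trans kt; apply: ler_sum => i _.
  by case: (pE i) => _ <-.
exists k => // p Gp; rewrite -excess_le0 subr_le0.
by apply: (kc (c p)); exists p.
Qed.

Lemma averaged_excess K n (p : 'I_n -> Y * Y) (z : 'I_n -> Y) (x0 z0 : Y) :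
    convex_set K -> K !=set0 ->
    (forall i j, dot ((p i).2 - (p j).2) ((p i).1 - (p j).1)
      <= `|(p i).1 - (p j).1| ^+ 2) ->
    (forall i, K ((p i).2 - z i)) ->
    (forall t : 'I_n -> R, (forall i, 0 <= t i) -> \sum_(i < n) t i = 1 ->
      dot (z0 - \sum_(i < n) t i *: z i) (x0 - \sum_(i < n) t i *: (p i).1)
        <= `|x0 - \sum_(i < n) t i *: (p i).1| ^+ 2) ->
  forall t : 'I_n -> R, (forall i, 0 <= t i) ->
    exists2 k, K k & \sum_(i < n) t i * excess x0 z0 (p i) k <= 0.
Proof.
move=> Kcv K0 pp Kz hz; apply: exists_normalized => // t t0 t1.
exists (\sum_(i < n) t i *: ((p i).2 - z i)); first exact: convex_set_sum.
exact: (averaged_shift (a := fun i => (p i).1) (w := fun i => (p i).2)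
  (z := z) dot_norm pp t0 t1 (hz t t0 t1)).
Qed.

Lemma closed_centered_ball (M : R) : closed [set x : Y | `|x| <= M].
Proof.
apply: (@closed_comp _ _ (@Num.norm _ Y) [set r | r <= M]); last exact: closed_le.
by move=> x _; exact: norm_continuous.
Qed.

Lemma convex_centered_ball (M : R) : convex_set [set x : Y | `|x| <= M].
Proof.
move=> x y l /set_mem/= xM /set_mem/= yM; apply/mem_set => /=.
have -> : conv l x y = l%:num *: x + (1 - l%:num : R) *: y by [].
have l0 : 0 <= l%:num by [].
have l1 : 0 <= 1 - l%:num by rewrite subr_ge0.
apply: le_trans (ler_normD _ _) _; rewrite !normrZ !ger0_norm//.
by have := lerD (ler_wpM2l l0 xM) (ler_wpM2l l1 yM); lra.
Qed.

(** The unconstrained problem for finitely many points: the constraint set is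
a ball containing all [w_i - a_i], and the map to be approximated is the
identity, for which the inequality at the barycenters is an equality whatever
their number. *)
Lemma finite_extension n (p : 'I_n -> Y * Y) (x0 : Y) :
    (forall i j, dot ((p i).2 - (p j).2) ((p i).1 - (p j).1)
      <= `|(p i).1 - (p j).1| ^+ 2) ->
  exists w, forall i, dot (w - (p i).2) (x0 - (p i).1) <= `|x0 - (p i).1| ^+ 2.
Proof.
move=> pp.
pose M := \sum_(i < n) `|(p i).2 - (p i).1|.
have pM i : `|(p i).2 - (p i).1| <= M.
  by rewrite /M (bigD1 i)//= lerDl; apply: sumr_ge0.
pose K := [set x : Y | `|x| <= M].
have K0 : K !=set0 by exists 0; rewrite /K /= normr0; apply: sumr_ge0.
have [|k _ kp] := @extension_minimax K M (range p) x0 x0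
  (@closed_centered_ball M) (@convex_centered_ball M) K0 (fun k kM => kM).
  move=> m q t pq; have /choice[f fE] i : exists j, p j = q i.
    by have [j _ jE] := pq i; exists j.
  apply: (averaged_excess (z := fun i => (q i).1)) => //.
  - exact: convex_centered_ball.
  - by move=> i j; rewrite -!fE; exact: pp.
  - by move=> i; rewrite -fE; exact: pM.
  - by move=> r _ _; rewrite dot_norm.
by exists (k + x0) => i; apply: kp; exists i.
Qed.

(** [averaged_excess] cannot be applied to all the given points, as there may be
more of them than the dimension; [finite_extension] supplies the base point
from which the Caratheodory reduction is carried out. *)
Lemma one_point_extension K (M : R) G (X : set Y) (v : Y -> Y) x0 :
    closed K -> convex_set K -> K !=set0 -> (forall k, K k -> `|k| <= M) ->
    (forall m : nat, (0 < m)%N -> le_dim Y m ->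
      forall (x : Y) (xs : 'I_m -> Y) (t : 'I_m -> R),
        X x -> (forall i, X (xs i)) ->
        (forall i, 0 <= t i) -> \sum_(i < m) t i = 1 ->
        dot (v x - \sum_(i < m) t i *: v (xs i))
            (x - \sum_(i < m) t i *: xs i)
          <= `|x - \sum_(i < m) t i *: xs i| ^+ 2) ->
    strain1_graph G -> (forall p, G p -> X p.1 /\ K (p.2 - v p.1)) -> X x0 ->
  exists2 w, K (w - v x0) & forall p, G p ->
    dot (w - p.2) (x0 - p.1) <= `|x0 - p.1| ^+ 2.
Proof.
move=> Kcl Kcv K0 KM hv Gs GX Xx0.
have [|k Kk kG] := @extension_minimax K M G x0 (v x0) Kcl Kcv K0 KM; last first.
  by exists (k + v x0) => //; rewrite addrK.
move=> n p t Gp t0; have GXp i := GX _ (Gp i).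
have [w wp] := @finite_extension n p x0 (fun i j => Gs _ _ (Gp i) (Gp j)).
pose b i := x0 - (p i).1.
pose s i := - excess x0 (v x0) (p i) (w - v x0).
have s0 i : 0 <= s i by rewrite /s oppr_ge0 excess_le0 subrK.
have excessE i k :
    excess x0 (v x0) (p i) k = dot (k - (w - v x0)) (b i) - s i.
  by rewrite /s /excess -/(b i) [dot (k - _) _]dotBl; ring.
have [m [f [t' [t'0 t'b t's bfree]]]] := conic_caratheodory b s0 t0.
have [|||k Kk kt'] := @averaged_excess K m (p \o f) (v \o fst \o p \o f)
    x0 (v x0) Kcv K0 _ _ _ t' t'0.
- by move=> i j; exact: Gs (Gp (f i)) (Gp (f j)).
- by move=> i; exact: (proj2 (GXp (f i))).
- move=> r r0 r1; apply: (hv m _ (le_dim_independent bfree)) => //.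
    case: m r r1 {f t' t'0 t'b t's bfree r0} => // r.
    by rewrite big_ord0 => /esym/eqP; rewrite oner_eq0.
  by move=> i; exact: (proj1 (GXp (f i))).
exists k => //; apply: le_trans kt'.
have sumE l (h : 'I_l -> 'I_n) (r : 'I_l -> R) :
    \sum_(i < l) r i * excess x0 (v x0) (p (h i)) k =
    dot (k - (w - v x0)) (\sum_(i < l) r i *: b (h i))
      - \sum_(i < l) r i * s (h i).
  rewrite dot_sumr -sumrB; apply: eq_bigr => i _.
  by rewrite excessE dotZr; ring.
by rewrite (sumE n id) (sumE m f) t'b lerD2l lerN2.
Qed.

End one_point_extension.

Theorem theorem1p5 (R : realType) (Y : completeNormedModType R)
    (dot : {dot Y for idfun}) (dot_norm : induces_norm dot)
    (X : set Y) (v : Y -> Y)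
    (hv : forall m : nat, (0 < m)%N -> le_dim Y m ->
      forall (x : Y) (xs : 'I_m -> Y) (t : 'I_m -> R),
        X x -> (forall i, X (xs i)) ->
        (forall i, 0 <= t i) -> \sum_(i < m) t i = 1 ->
        dot (v x - \sum_(i < m) t i *: v (xs i))
            (x - \sum_(i < m) t i *: xs i)
          <= `|x - \sum_(i < m) t i *: xs i| ^+ 2) :
  forall K : set Y,
    closed K -> bounded_set K -> convex_set K -> K !=set0 ->
  forall (A : set Y) (u : Y -> Y),
    A `<=` X -> semi_bounded_strain1 dot A u ->
    (forall x, A x -> K (u x - v x)) ->
  exists u' : Y -> Y,
    [/\ forall x, A x -> u' x = u x,
        semi_bounded_strain1 dot X u'
      & forall x, X x -> K (u' x - v x)].
Proof.
move=> K Kcl [M0 [_ KM0]] Kcv K0 A u AX us Ku.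
have KM k : K k -> `|k| <= M0 + 1 by apply: KM0; rewrite ltrDl.
(* the chain may be empty, so the graph of u is adjoined to H in the condition
   used for Zorn's lemma rather than required to be contained in H *)
pose good (H : set (Y * Y)) :=
  strain1_graph dot H /\ forall p, H p -> X p.1 /\ K (p.2 - v p.1).
pose G0 := [set (x, u x) | x in A].
have good0 : good G0.
  split; first by move=> _ _ [x Ax <-] [y Ay <-]; exact: us.
  by move=> _ [x Ax <-]; split; [exact: AX | exact: Ku].
have [F FP Ftot|G [[Gs GX] Gmax]] :=
    @Zorn_bigcup _ [set H : set (Y * Y) | good (H `|` G0)].
  have common p q : (\bigcup_(H in F) H `|` G0) p ->
      (\bigcup_(H in F) H `|` G0) q ->
      exists H, [/\ good H, H p & H q].
    move=> [[H FH Hp]|Gp] [[H' FH' Hq]|Gq].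
    - have [HH'|H'H] := Ftot _ _ FH FH'.
        by exists (H' `|` G0); split; [exact: FP | left; exact: HH' | left].
      by exists (H `|` G0); split; [exact: FP | left | left; exact: H'H].
    - by exists (H `|` G0); split; [exact: FP | left | right].
    - by exists (H' `|` G0); split; [exact: FP | right | left].
    - by exists G0.
  split.
    by move=> p q Up Uq; have [H [[Hs _] Hp Hq]] := common _ _ Up Uq; exact: Hs.
  by move=> p Up; have [H [[_ HX] Hp _]] := common _ _ Up Up; exact: HX.
(* at a point outside its domain the maximal graph could be extended *)
have /choice[g gG] x : exists w, X x -> (G `|` G0) (x, w).
  have [Xx|nXx] := pselect (X x); last by exists 0.
  apply: contrapT => /forallNP noG.
  have {}noG w : ~ (G `|` G0) (x, w) by move=> Gw; apply: (noG w).
  have [w Kw wG] := one_point_extension dot_norm Kcl Kcv K0 KM hv Gs GX Xx.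
  apply: (Gmax (G `|` [set (x, w)])).
    split; first by move=> p; left.
    by move=> sub; apply: (noG w); left; apply: sub; right.
  split; last first.
    by move=> p [[Gp|->]|G0p]; [apply: GX; left | | apply: GX; right].
  have memG p : ((G `|` [set (x, w)]) `|` G0) p -> p = (x, w) \/ (G `|` G0) p.
    by move=> [[Gp|->]|G0p]; [right; left | left | right; right].
  move=> p q /memG[->|Gp] /memG[->|Gq] /=.
  - by rewrite !subrr dot_norm.
  - exact: wG.
  - rewrite -(opprB w) -(opprB x) dotNr dotC dotNr opprK dotC normrN; exact: wG.
  - exact: Gs.
pose u' x := if pselect (A x) then u x else g x.
have u'G x : X x -> (G `|` G0) (x, u' x).
  by rewrite /u'; case: pselect => [Ax|nAx] Xx; [right; exists x | exact: gG].
exists u'; split.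
- by move=> x Ax; rewrite /u'; case: pselect.
- by move=> x y Xx Xy; exact: (Gs _ _ (u'G _ Xx) (u'G _ Xy)).
- by move=> x Xx; case: (GX _ (u'G _ Xx)).
Qed.
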